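(* Let $L$ be a finite-dimensional restricted Lie algebra over a field $\mathbb{F}$ of prime characteristic. Then $$[\operatorname{Jac}(u(L))P_L(\mathbb{F})/\operatorname{Jac}(u(L))^2P_L(\mathbb{F}):S]\ge[L:S]_{\rm split}$$ holds for every non-trivial irreducible restricted $L$-module $S$.
   Context: For a finite-dimensional restricted Lie algebra $L$ over $\mathbb{F}$, $u(L)$ denotes its restricted universal enveloping algebra, a finite-dimensional unital associative algebra whose modules are exactly the restricted $L$-modules. $\operatorname{Jac}(A)$ denotes the Jacobson radical of a finite-dimensional associative algebra $A$. $P_L(\mathbb{F}):=P_{u(L)}(\mathbb{F})$ denotes the projective cover of the trivial irreducible $L$-module $\mathbb{F}$ as a $u(L)$-module. $[M:S]$ denotes the multiplicity of $S$ as a composition factor of $M$. ''Non-trivial'' means not isomorphic to $\mathbb{F}$. A chief series of a finite-dimensional Lie algebra $L$ is an ascending chain $0=L_0\subset L_1\subset\cdots\subset L_n=L$ of (ordinary) ideals of $L$ such that $L_j/L_{j-1}$ is a minimal (non-zero) ideal of $L/L_{j-1}$ for every $1\le j\le n$; each $L_j/L_{j-1}$ is called a chief factor, and it is an $L$-module via the adjoint action. It is called an abelian chief factor if it is an abelian Lie algebra. For a finite-dimensional irreducible $L$-module $S$ and a given chief series of $L$, $[L:S]_{\rm split}$ denotes the number of indices $j$ such that $L_j/L_{j-1}$ is an abelian chief factor isomorphic to $S$ as an $L$-module and the exact sequence $0\to L_j/L_{j-1}\to L/L_{j-1}\to L/L_j\to 0$ splits in the category of (ordinary) Lie algebras. This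 number does not depend on the choice of the chief series. *)

(* Defs.v *)
From HB Require Import structures.
From mathcomp Require Import all_boot all_order all_algebra falgebra.
From mathcomp Require Import mathcomp_extra boolp classical_sets.

Set Implicit Arguments.
Unset Strict Implicit.
Unset Printing Implicit Defensive.

Import GRing.Theory.
Local Open Scope ring_scope.

(* The quotient V / U, carried by the chosen complement U^C; quot_proj U is
   the canonical projection (see lker_quot_proj, limg_quot_proj) and quot_repr
   a linear section of it. *)
Section QuotientSpace.

Variables (F : fieldType) (V : vectType F) (U : {vspace V}).

Definition quot_space : vectType F := subvs_of (U^C)%VS.

Definition quot_proj : 'Hom(V, quot_space) :=
  (linfun (vsproj (U^C)%VS) \o daddv_pi (U^C)%VS U)%VF.

Definition quot_repr : 'Hom(quot_space, V) := linfun vsval.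

Lemma quot_reprK u : quot_proj (quot_repr u) = u.
Proof.
by rewrite comp_lfunE !lfunE /= daddv_pi_id ?vsvalK ?subvsP // capvC capv_compl.
Qed.

Lemma lker_quot_proj : lker quot_proj = U.
Proof.
have key v : daddv_pi (U^C) U v + daddv_pi U (U^C) v = v.
  by rewrite daddv_pi_add ?[(U^C :&: _)%VS]capvC ?capv_compl // addvC addv_complf memvf.
apply/vspaceP=> v; rewrite memv_ker comp_lfunE lfunE /=; apply/eqP/idP => [|Uv].
  move=> /(congr1 vsval); rewrite vsprojK ?memv_pi // raddf0 => w0.
  by rewrite -[v]key w0 add0r memv_pi.
have /(canRL (addrK _)) := key v.
by rewrite (daddv_pi_id _ Uv) ?capv_compl // subrr => ->; rewrite linear0.
Qed.

Lemma quot_proj_eq0 v : (quot_proj v == 0) = (v \in U).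
Proof. by rewrite -memv_ker lker_quot_proj. Qed.

Lemma quot_repr_sub v : v - quot_repr (quot_proj v) \in U.
Proof. by rewrite -quot_proj_eq0 linearB /= quot_reprK subrr. Qed.

Lemma eq_quot_proj v w : v - w \in U -> quot_proj v = quot_proj w.
Proof. by rewrite -quot_proj_eq0 linearB subr_eq0 => /eqP. Qed.

Lemma limg_quot_proj : limg quot_proj = fullv.
Proof.
apply/eqP; rewrite eqEsubv subvf /=; apply/subvP=> u _.
by rewrite -[u]quot_reprK memv_img ?memvf.
Qed.

End QuotientSpace.

Section Modules.

Variables (F : fieldType) (X : Type).

(* A finite-dimensional space on which X acts by linear endomorphisms; the
   predicates lie_module, restricted_module and algebra_module below say when
   it is a module over a Lie algebra or an associative algebra. *)
Record opmod := OpMod { car :> vectType F; act : X -> 'End(car) }.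

Implicit Types M N : opmod.

Definition mod_hom M N (f : 'Hom(M, N)) : Prop :=
  forall x v, f (act M x v) = act N x (f v).

Definition mod_iso M N : Prop :=
  exists f : 'Hom(M, N), [/\ mod_hom f, lker f = 0%VS & limg f = fullv].

Definition submodule M (U : {vspace M}) : Prop :=
  forall x v, v \in U -> act M x v \in U.

Definition irreducible M : Prop :=
  (fullv != 0 :> {vspace M})%VS /\
  forall U : {vspace M}, submodule U -> U = 0%VS \/ U = fullv.

(* The next three are the expected modules when U and W are submodules. *)
Definition sub_mod M (W : {vspace M}) : opmod :=
  @OpMod (subvs_of W)
    (fun x => (linfun (vsproj W) \o act M x \o linfun vsval)%VF).

Definition quot_mod M (U : {vspace M}) : opmod :=
  @OpMod (quot_space U) (fun x => (quot_proj U \o act M x \o quot_repr U)%VF).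

(* W / U for U <= W, as a submodule of M / U *)
Definition factor M (W U : {vspace M}) : opmod :=
  @sub_mod (quot_mod U) (quot_proj U @: W)%VS.

Lemma quot_proj_hom M (U : {vspace M}) :
  submodule U -> @mod_hom M (quot_mod U) (quot_proj U).
Proof.
move=> sU x v.
have E : quot_proj U (act M x v) =
    quot_proj U (act M x (quot_repr U (quot_proj U v))).
  by apply: eq_quot_proj; rewrite -linearB /=; exact/sU/quot_repr_sub.
by do 2![rewrite [RHS]comp_lfunE]; exact: E.
Qed.

Definition comp_series M n (U : nat -> {vspace M}) : Prop :=
  [/\ U 0%N = 0%VS, U n = fullv,
      forall i, (i <= n)%N -> submodule (U i) &
      forall i, (i < n)%N ->
        (U i <= U i.+1)%VS /\ irreducible (factor (U i.+1) (U i))].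

(* the multiplicity [M : S], counted along a composition series of M *)
Definition comp_mult M n (U : nat -> {vspace M}) (S : opmod) : nat :=
  #|[set i : 'I_n | `[< mod_iso (factor (U i.+1) (U i)) S >]]|.

End Modules.

Section Algebras.

Variables (F : fieldType) (A : falgType F).

Definition algebra_module (M : opmod F A) : Prop :=
  [/\ linear (act M), act M 1 = \1%VF &
      forall a b, act M (a * b) = (act M a \o act M b)%VF].

Definition left_ideal (I : {vspace A}) : Prop :=
  forall a x, x \in I -> a * x \in I.

Definition maximal_left_ideal (I : {vspace A}) : Prop :=
  [/\ left_ideal I, I <> fullv &
      forall J, left_ideal J -> (I <= J)%VS -> J = I \/ J = fullv].

(* the intersection of all maximal left ideals, see mem_jacobson *)
Definition jacobson : {vspace A} :=
  xget 0%VS [set J : {vspace A} | forall a, a \in J <->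
    forall I, maximal_left_ideal I -> a \in I].

(* I M: the span of the a v with a in I and v in M *)
Definition ideal_mul (I : {vspace A}) (M : opmod F A) : {vspace M} :=
  <<[seq act M a v | a <- vbasis I, v <- vbasis (fullv : {vspace M})]>>%VS.

Definition projective (P : opmod F A) : Prop :=
  algebra_module P /\
  forall (M N : opmod F A) (f : 'Hom(M, N)) (g : 'Hom(P, N)),
    algebra_module M -> algebra_module N ->
    mod_hom f -> limg f = fullv -> mod_hom g ->
    exists2 h : 'Hom(P, M), mod_hom h & (f \o h)%VF = g.

Definition projective_cover (T P : opmod F A) (pi : 'Hom(P, T)) : Prop :=
  [/\ projective P, mod_hom pi, limg pi = fullv &
      forall N : {vspace P}, submodule N -> (N + lker pi = fullv)%VS ->
        N = fullv].

Lemma mem_jacobson a :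
  a \in jacobson <-> forall I, maximal_left_ideal I -> a \in I.
Proof.
suff /xgetPex H : exists J : {vspace A}, [set J : {vspace A} |
    forall a, a \in J <-> forall I, maximal_left_ideal I -> a \in I]%classic J.
  exact: H.
pose inj (J : {vspace A}) :=
  `[< forall I, maximal_left_ideal I -> (J <= I)%VS >].
have ex0 : exists d, `[< exists2 J, inj J & \dim J = d >].
  by exists 0%N; apply/asboolP; exists 0%VS; rewrite ?dimv0 //;
    apply/asboolP=> I _; rewrite sub0v.
have bnd d : `[< exists2 J, inj J & \dim J = d >] -> (d <= dim A)%N.
  by move=> /asboolP[J _ <-]; rewrite -dimvf dimvS ?subvf.
case: (ex_maxnP ex0 bnd) => d /asboolP[J /asboolP Jin dJ] dmax.
exists J => b; split=> [Jb I /Jin /subvP|bI]; first exact.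
have injb : inj (J + <[b]>)%VS.
  by apply/asboolP=> I mI; rewrite subv_add Jin //= -memvE bI.
have /eqP -> : J == (J + <[b]>)%VS.
  rewrite eqEdim addvSl /= dJ; apply: dmax.
  by apply/asboolP; exists (J + <[b]>)%VS.
by rewrite memvE addvSr.
Qed.

End Algebras.

Record lieAlg (F : fieldType) := LieAlg {
  lie_car :> vectType F;
  br : lie_car -> lie_car -> lie_car;
  br_linl : forall z, linear (br^~ z);
  br_linr : forall z, linear (br z);
  br_alt : forall x, br x x = 0;
  br_jacobi : forall x y z, br x (br y z) + br y (br z x) + br z (br x y) = 0
}.

Section LieAlgebras.

Variable F : fieldType.
Implicit Types L G : lieAlg F.

Record lideal L := LIdeal {
  lideal_sp :> {vspace L};
  lidealP : forall x y, y \in lideal_sp -> br x y \in lideal_sp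
}.

Definition lie_hom L G (f : 'Hom(L, G)) : Prop :=
  forall x y, f (br x y) = br (f x) (f y).

Lemma brC L (x y : L) : br x y = - br y x.
Proof.
have linl a b c : br (a + b) c = br a c + br b c :> L.
  by have /= := br_linl c 1 a b; rewrite !scale1r.
have linr a b c : br c (a + b) = br c a + br c b :> L.
  by have /= := br_linr c 1 a b; rewrite !scale1r.
have /eqP := br_alt (x + y).
by rewrite linl !linr !br_alt add0r addr0 addr_eq0 => /eqP.
Qed.

Lemma brBl L (x y z : L) : br (x - y) z = br x z - br y z.
Proof. by have /= := br_linl z (-1) y x; rewrite !scaleN1r !(addrC (- _)). Qed.

Lemma brBr L (x y z : L) : br z (x - y) = br z x - br z y.
Proof. by have /= := br_linr z (-1) y x; rewrite !scaleN1r !(addrC (- _)). Qed.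

Section QuotientLie.

Variables (L : lieAlg F) (I : lideal L).

Definition quot_br (u v : quot_space I) : quot_space I :=
  quot_proj I (br (quot_repr I u) (quot_repr I v)).

Lemma quot_proj_br x y :
  quot_proj I (br x y) = quot_br (quot_proj I x) (quot_proj I y).
Proof.
apply: eq_quot_proj.
set x' := quot_repr I _; set y' := quot_repr I _.
rewrite -(subrK (br x y') (br x y)) -addrA -brBr -brBl memvD //.
  exact/lidealP/quot_repr_sub.
by rewrite brC memvN; apply/lidealP/quot_repr_sub.
Qed.

Fact quot_br_linl z : linear (quot_br^~ z).
Proof.
by move=> a u v; rewrite /quot_br linearP (br_linl (quot_repr I z)) linearP.
Qed.

Fact quot_br_linr z : linear (quot_br z).
Proof.
by move=> a u v; rewrite /quot_br linearP (br_linr (quot_repr I z)) linearP.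
Qed.

Fact quot_br_alt u : quot_br u u = 0.
Proof. by rewrite /quot_br br_alt linear0. Qed.

Fact quot_br_jacobi u v w :
  quot_br u (quot_br v w) + quot_br v (quot_br w u) +
  quot_br w (quot_br u v) = 0.
Proof.
rewrite -[u]quot_reprK -[v]quot_reprK -[w]quot_reprK -!quot_proj_br -!linearD.
by rewrite br_jacobi linear0.
Qed.

Definition quot_lie : lieAlg F :=
  LieAlg quot_br_linl quot_br_linr quot_br_alt quot_br_jacobi.

End QuotientLie.

Definition minimal_ideal G (K : {vspace G}) : Prop :=
  [/\ K <> 0%VS, forall x y, y \in K -> br x y \in K &
      forall J : lideal G, (J <= K)%VS -> J = 0%VS :> {vspace G} \/
        J = K :> {vspace G}].

Definition chief_series L n (I : nat -> lideal L) : Prop :=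
  [/\ I 0%N = 0%VS :> {vspace L}, I n = fullv :> {vspace L} &
      forall j, (j < n)%N -> (I j <= I j.+1)%VS /\
        @minimal_ideal (quot_lie (I j)) (quot_proj (I j) @: I j.+1)%VS].

Definition adjoint L : opmod F L := @OpMod F L L (fun x => linfun (br x)).

Definition abelian_factor L (J I : lideal L) : Prop :=
  forall u v : quot_lie I, u \in (quot_proj I @: J)%VS ->
    v \in (quot_proj I @: J)%VS -> br u v = 0.

(* the canonical map L / I -> L / J for I <= J *)
Definition quot_quot L (J I : lideal L) : 'Hom(quot_lie I, quot_lie J) :=
  (quot_proj J \o quot_repr I)%VF.

(* 0 -> J / I -> L / I -> L / J -> 0 splits: some Lie algebra homomorphism is
   a section of L / I -> L / J. *)
Definition split_factor L (J I : lideal L) : Prop :=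
  exists2 s : 'Hom(quot_lie J, quot_lie I),
    lie_hom s & forall u, quot_quot J I (s u) = u.

(* [L : S]_split, counted along a chief series *)
Definition split_mult L n (I : nat -> lideal L) (S : opmod F L) : nat :=
  #|[set j : 'I_n | `[< [/\ abelian_factor (I j.+1) (I j),
      mod_iso (@factor F L (adjoint L) (I j.+1) (I j)) S &
      split_factor (I j.+1) (I j)] >]]|.

Definition lie_module L (M : opmod F L) : Prop :=
  linear (act M) /\ forall x y v,
    act M (br x y) v = act M x (act M y v) - act M y (act M x v).

Definition trivial_module L : opmod F L := @OpMod F L F^o (fun=> 0).

(* The coefficient of t ^ k in (ad (t x + y)) ^ n (x), in L[t]. *)
Fixpoint ad_coef L (x y : L) (n k : nat) : L :=
  if n is m.+1 then
    br y (ad_coef x y m k) +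
    (if k is l.+1 then br x (ad_coef x y m l) else 0)
  else if k == 0%N then x else 0.

(* i s_i(x, y) is the coefficient of t ^ (i - 1) in (ad (t x + y)) ^ (p - 1) (x) *)
Definition jacobson_s p L (i : nat) (x y : L) : L :=
  (i%:R)^-1 *: ad_coef x y p.-1 i.-1.

End LieAlgebras.

Record restrictedLieAlg (F : fieldType) (p : nat) := RestrictedLieAlg {
  rlie_lie :> lieAlg F;
  pmap : rlie_lie -> rlie_lie;
  br_pmap : forall x y, br (pmap x) y = iter p (br x) y;
  pmapZ : forall a x, pmap (a *: x) = a ^+ p *: pmap x;
  pmapD : forall x y,
    pmap (x + y) = pmap x + pmap y + \sum_(1 <= i < p) jacobson_s p i x y
}.

(* End(V) with composition as product *)
Section EndAlgebra.

Variables (F : fieldType) (V : vectType F).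
Hypothesis V_proper : (0 < dim V)%N.

Let ring := lfun_comp_nzRingType V_proper.
Let lalg_mixin := GRing.Lmodule_isLalgebra.Build F ring
  (fun k (x y : 'End(V)) => comp_lfunZl k x y).
Let lalg : lalgType F := HB.pack 'End(V) ring lalg_mixin.
Let alg_mixin := GRing.Lalgebra_isAlgebra.Build F lalg
  (fun k (x y : 'End(V)) => comp_lfunZr k x y).

Definition end_algType : algType F := HB.pack 'End(V) lalg alg_mixin.

End EndAlgebra.

Section Enveloping.

Variables (F : fieldType) (p : nat) (L : restrictedLieAlg F p).

Definition restricted_module (M : opmod F L) : Prop :=
  lie_module M /\ forall x v, act M (pmap x) v = iter p (act M x) v.

Definition restricted_hom (B : algType F) (f : {linear L -> B}) : Prop :=
  (forall x y, f (br x y) = f x * f y - f y * f x) /\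
  (forall x, f (pmap x) = f x ^+ p).

(* (A, iota) is the restricted universal enveloping algebra u(L). *)
Definition restricted_enveloping (A : falgType F) (iota : {linear L -> A}) :
  Prop :=
  restricted_hom iota /\
  forall (B : algType F) (f : {linear L -> B}), restricted_hom f ->
    (exists g : {lrmorphism A -> B}, forall x, g (iota x) = f x) /\
    (forall g h : {lrmorphism A -> B},
       (forall x, g (iota x) = h (iota x)) -> g =1 h).

(* The u(L)-module structure carried by a restricted L-module, see
   env_moduleP. *)
Definition env_module (A : falgType F) (iota : {linear L -> A})
    (M : opmod F L) : opmod F A :=
  @OpMod F A M (xget (0 : 'Hom(A, 'End(M)))
    [set r : 'Hom(A, 'End(M)) |
      @algebra_module F A (@OpMod F A M r) /\ forall x, r (iota x) = act M x]).

Lemma env_moduleP (A : falgType F) (iota : {linear L -> A}) (M : opmod F L) :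
  restricted_enveloping iota -> restricted_module M ->
  algebra_module (env_module iota M) /\
  forall x, act (env_module iota M) (iota x) = act M x.
Proof.
move=> [_ univ] [[linM brM] pM]; rewrite /env_module.
set P := [set r | _]%classic.
suff /xgetPex : exists r, P r by move=> /(_ 0).
have [dM0|dM_gt0] := posnP (dim M).
  have M0 (v : M) : v = 0.
    have := memvf v; have /eqP : \dim {:M} = 0%N by rewrite dimvf.
    by rewrite dimv_eq0 => /eqP ->; rewrite memv0 => /eqP.
  have eq_end (f g : 'End(M)) : f = g by apply/lfunP=> v; rewrite (M0 (f v)) (M0 (g v)).
  by exists 0; split; [split=> [c a b||a b]; apply: eq_end|move=> x; apply: eq_end].
pose B := end_algType dM_gt0.
have lin_r : linear (act M : L -> B) by move=> a x y; apply: linM.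
pose mL := GRing.isLinear.Build F L B *:%R (act M : L -> B) lin_r.
pose f : {linear L -> B} := HB.pack (act M : L -> B) mL.
have pow x k v : iter k (act M x) v = (f x ^+ k : 'End(M)) v.
  elim: k => [|k IH]; first by rewrite expr0 id_lfunE.
  by rewrite exprS comp_lfunE /= IH.
have [|[g gE] _] := univ B f.
  split=> [x y|x]; apply/lfunP=> v.
    by rewrite brM add_lfunE opp_lfunE !comp_lfunE.
  by rewrite pM pow.
have lin_g : linear (g : A -> 'End(M)) by move=> c a b; apply: (linearP g).
pose ml := GRing.isLinear.Build F A 'End(M) *:%R (g : A -> 'End(M)) lin_g.
pose gl : {linear A -> 'End(M)} := HB.pack (g : A -> 'End(M)) ml.
have rE a : linfun gl a = g a by rewrite lfunE.
exists (linfun gl); split; last by move=> x; rewrite rE gE.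
split=> [c a b||a b] /=; first exact: linearP.
  by rewrite rE rmorph1.
by rewrite !rE rmorphM.
Qed.

End Enveloping.

(* Main.v *)
Require Import Defs.
From HB Require Import structures.
From mathcomp Require Import all_boot all_order all_algebra falgebra.
From mathcomp Require Import boolp.

(** Write J for the radical of u(L), P for the projective cover of the trivial
    module F, and let j run over the split abelian chief factors
    I_(j+1) / I_j isomorphic to S.  Each of them gives a derivation d_j : L -> S
    that vanishes on I_j and maps I_(j+1) onto S: subtract from x the part that
    lies in a complement of the factor ([split_derivation]).  All of them
    together form one derivation d into the power N of S indexed by these j,
    hence an extension E = N x F of F by N.

    The module E is restricted, thus a u(L)-module, because N has no nonzero
    invariants: the defect d(x^[p]) - x^(p-1) d(x) is always invariant
    ([ext_restricted]).  Lift P -> F along E -> F to h : P -> E.  The image of h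
    contains a vector (n0, 1), hence all vectors (x n0 + d x, 0).  The ideal
    I_(j+1) kills S and all d_i with i > j, so letting x run over I_(j+1), for
    j = 0, 1, ..., shows that the image contains one copy of S in N after the
    other ([pow_der_spans]).  Therefore h maps the kernel of P -> F onto N.
    That kernel is J P ([cover_kernel]), and J N = 0, so that h induces a
    surjection of J P / J^2 P onto N ([radical_layer_onto]).

    Finally, a module that maps onto a direct sum of m copies of the
    irreducible S has at least m composition factors isomorphic to S
    ([leq_comp_mult_pow]). *)

Set Implicit Arguments.
Unset Strict Implicit.
Unset Printing Implicit Defensive.

Import GRing.Theory.
Local Open Scope ring_scope.

Lemma linfunE (F : fieldType) (V W : vectType F) (f : V -> W) :
  linear f -> linfun f =1 f.
Proof.
move=> lf; pose mf := GRing.isLinear.Build F V W *:%R f lf.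
by pose g : {linear V -> W} := HB.pack f mf; apply: (lfunE g).
Qed.

(** * Submodules, factors and powers of an irreducible module *)
Section Submodules.

Variables (F : fieldType) (X : Type).
Implicit Types M N S : opmod F X.

Lemma submodule_cap M (U W : {vspace M}) :
  submodule U -> submodule W -> submodule (U :&: W)%VS.
Proof. by move=> sU sW x v; rewrite !memv_cap => /andP[/(sU x) -> /(sW x)]. Qed.

Lemma submodule_add M (U W : {vspace M}) :
  submodule U -> submodule W -> submodule (U + W)%VS.
Proof.
move=> sU sW x v /memv_addP[u Uu [w Ww ->]].
by rewrite linearD memv_add ?sU ?sW.
Qed.

Lemma submodule_lker M N (f : 'Hom(M, N)) : mod_hom f -> submodule (lker f).
Proof.
by move=> hf x v; rewrite !memv_ker hf => /eqP ->; rewrite linear0.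
Qed.

Lemma submodule_limg M N (f : 'Hom(M, N)) (U : {vspace M}) :
  mod_hom f -> submodule U -> submodule (f @: U)%VS.
Proof.
move=> hf sU x _ /memv_imgP[u Uu ->].
by rewrite -hf memv_img ?sU.
Qed.

Lemma mod_hom_comp M N S (f : 'Hom(M, N)) (g : 'Hom(N, S)) :
  mod_hom f -> mod_hom g -> mod_hom (g \o f)%VF.
Proof. by move=> hf hg x v; rewrite !comp_lfunE hf hg. Qed.

Definition maximal_submodule M (Q : {vspace M}) : Prop :=
  [/\ submodule Q, Q <> fullv &
      forall Z : {vspace M}, submodule Z -> (Q <= Z)%VS -> Z = Q \/ Z = fullv].

(** The one fact about semisimplicity that the proof rests on.  When the
    members of [maxl] intersect in R and Y contains R, it says that Y / R has
    a complement in M / R.  Take C of least dimension with C + Y = M: if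
    C :&: Y were not inside a maximal submodule Q, then C :&: Q would be a
    smaller choice. *)
Lemma relative_complement M (maxl : {vspace M} -> Prop) (Y : {vspace M}) :
  (forall Q, maxl Q -> maximal_submodule Q) -> submodule Y ->
  exists C : {vspace M}, [/\ submodule C, (C + Y)%VS = fullv &
    forall Q, maxl Q -> (C :&: Y <= Q)%VS].
Proof.
move=> max_maxl sY.
pose good d := `[< exists C : {vspace M},
  [/\ submodule C, (C + Y)%VS = fullv & \dim C = d] >].
have ex_good : exists d, good d.
  exists (\dim {:M}); apply/asboolP; exists fullv; split=> //.
    by move=> x v _; apply: memvf.
  by apply/eqP; rewrite eqEsubv subvf addvSl.
case: (ex_minnP ex_good) => d /asboolP[C [sC CY dC]] min_d.
exists C; split=> // Q /max_maxl[sQ nQ maxQ].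
have [CQ|nCQ] := boolP (C <= Q)%VS; first exact: subv_trans (capvSl _ _) CQ.
apply: contrapT => nCYQ.
have CQY : (C :&: Y + Q)%VS = fullv.
  have [|||//] := maxQ (C :&: Y + Q)%VS.
  - exact/submodule_add/sQ/submodule_cap.
  - exact: addvSr.
  - by move=> E; case: nCYQ; rewrite -E addvSl.
have : (d <= \dim (C :&: Q))%N.
  apply: min_d; apply/asboolP; exists (C :&: Q)%VS; split=> //.
    exact: submodule_cap.
  apply/eqP; rewrite eqEsubv subvf /= -CY subv_add addvSr andbT.
  apply/subvP=> c Cc; have := memvf c; rewrite -CQY.
  case/memv_addP=> y; rewrite memv_cap => /andP[Cy Yy] [q Qq Ec].
  rewrite Ec addrC memv_add // memv_cap Qq andbT.
  by rewrite (_ : q = c - y) ?memvB // Ec addrC addKr.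
rewrite -dC => le; case/negP: nCQ.
have /eqP <- : (C :&: Q)%VS == C by rewrite eqEdim capvSl.
exact: capvSr.
Qed.

Lemma lker_maximal M S (f : 'Hom(M, S)) :
  irreducible S -> mod_hom f -> f <> 0 -> maximal_submodule (lker f).
Proof.
move=> [_ irrS] hf nf; split; first exact: submodule_lker.
  move=> E; apply: nf; apply/lfunP=> v; apply/eqP.
  by rewrite zero_lfunE -memv_ker E memvf.
move=> Z sZ kZ; case: (irrS (f @: Z)%VS); first exact: submodule_limg.
  by move=> /eqP; rewrite -lkerE => Zk; left; apply/eqP; rewrite eqEsubv kZ Zk.
move=> E; right; apply/eqP; rewrite eqEsubv subvf /=; apply/subvP=> v _.
have : f v \in (f @: Z)%VS by rewrite E memvf.
case/memv_imgP=> z Zz Ez; rewrite -[v](subrK z) memvD //.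
by apply: (subvP kZ); rewrite memv_ker linearB /= Ez subrr.
Qed.

(** The map W / U -> N induced by f, for f vanishing on U.  As f is a linear
    map on all of M, it may be equivariant on W only. *)
Definition factor_map M N (W U : {vspace M}) (f : 'Hom(M, N)) :
  'Hom(factor W U, N) := (f \o quot_repr U \o linfun vsval)%VF.

Definition factor_proj M (W U : {vspace M}) : 'Hom(M, factor W U) :=
  (linfun (vsproj (quot_proj U @: W)%VS) \o quot_proj U)%VF.

Lemma factor_projE M (W U : {vspace M}) v :
  factor_proj W U v = vsproj (quot_proj U @: W)%VS (quot_proj U v).
Proof. by rewrite [LHS]comp_lfunE lfunE. Qed.

Lemma factor_projP M (W U : {vspace M}) (t : factor W U) :
  exists2 w, w \in W & t = factor_proj W U w.
Proof.
have /memv_imgP[w Ww Et] := subvsP t.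
by exists w => //; apply: val_inj; rewrite factor_projE /= vsprojK ?memv_img.
Qed.

Lemma factor_proj_act M (W U : {vspace M}) x w :
  submodule U -> w \in W ->
  factor_proj W U (act M x w) = act (factor W U) x (factor_proj W U w).
Proof.
move=> sU Ww; rewrite 2!factor_projE (quot_proj_hom sU).
rewrite -{1}(vsprojK (memv_img (quot_proj U) Ww)).
do 2![rewrite [RHS]comp_lfunE]; rewrite [RHS]lfunE.
by rewrite [X in _ = vsproj _ (_ X)]lfunE.
Qed.

Lemma factor_mapE M N (W U : {vspace M}) (f : 'Hom(M, N)) w :
  (forall u, u \in U -> f u = 0) -> w \in W ->
  factor_map W U f (factor_proj W U w) = f w.
Proof.
move=> fU Ww; rewrite factor_projE [LHS]comp_lfunE [LHS]comp_lfunE.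
rewrite [X in f (_ X)]lfunE [X in f (_ X)]vsprojK ?memv_img //.
by apply/esym/eqP; rewrite -subr_eq0 -linearB; apply/eqP/fU/quot_repr_sub.
Qed.

Lemma factor_map_hom M N (W U : {vspace M}) (f : 'Hom(M, N)) :
  submodule U -> submodule W -> (forall u, u \in U -> f u = 0) ->
  (forall x w, w \in W -> f (act M x w) = act N x (f w)) ->
  mod_hom (factor_map W U f).
Proof.
move=> sU sW fU hf x t; have [w Ww ->] := factor_projP t.
by rewrite -(factor_proj_act x sU Ww) !factor_mapE ?hf ?sW.
Qed.

Lemma schur M N (f : 'Hom(M, N)) :
  irreducible M -> irreducible N -> mod_hom f -> f <> 0 -> mod_iso M N.
Proof.
move=> [_ irrM] [_ irrN] hf nf; exists f; split=> //.
  have [//|E] := irrM _ (submodule_lker hf); case: nf; apply/lfunP=> v.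
  by apply/eqP; rewrite zero_lfunE -memv_ker E memvf.
have sf : submodule (fullv : {vspace M}) by move=> x v _; apply: memvf.
have [E|//] := irrN _ (submodule_limg hf sf); case: nf; apply/lfunP=> v.
by apply/eqP; rewrite zero_lfunE -memv0 -E memv_img ?memvf.
Qed.

Lemma mod_iso_dim M N : mod_iso M N -> dim M = dim N.
Proof.
move=> [f [_ kf imf]]; have := limg_ker_dim f fullv.
by rewrite kf imf capv0 dimv0 !dimvf.
Qed.

Lemma dim_factor M (W U : {vspace M}) :
  (U <= W)%VS -> \dim W = (\dim U + dim (factor W U))%N.
Proof.
move=> UW; rewrite -(limg_ker_dim (quot_proj U) W) lker_quot_proj.
by rewrite (capv_idPr UW).
Qed.

Lemma factor_iso M S (W U : {vspace M}) (f : 'Hom(M, S)) w :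
  submodule U -> submodule W -> irreducible (factor W U) -> irreducible S ->
  mod_hom f -> (forall u, u \in U -> f u = 0) -> w \in W -> f w != 0 ->
  mod_iso (factor W U) S.
Proof.
move=> sU sW irrWU irrS hf fU Ww fw.
apply: (schur (f := factor_map W U f)) => //.
  exact: factor_map_hom.
move=> /lfunP/(_ (factor_proj W U w)); rewrite factor_mapE // zero_lfunE.
by move/eqP; apply/negP.
Qed.

Definition pow_mod (J : finType) S : opmod F X :=
  @OpMod F X {ffun J -> S}
    (fun x => linfun (fun f : {ffun J -> S} => [ffun j => act S x (f j)])).

Lemma act_powE (J : finType) S x (f : pow_mod J S) j :
  (act (pow_mod J S) x f) j = act S x (f j).
Proof.
rewrite /= linfunE ?ffunE // => a u v; apply/ffunP=> i.
by rewrite !ffunE linearP.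
Qed.

Definition pow_coord (J : finType) S (j : J) : 'Hom(pow_mod J S, S) :=
  linfun (fun f : pow_mod J S => f j).

Lemma pow_coordE (J : finType) S (j : J) f : pow_coord S j f = f j.
Proof. by rewrite linfunE // => a u v; rewrite !ffunE. Qed.

Lemma pow_coord_hom (J : finType) S (j : J) : mod_hom (pow_coord S j).
Proof. by move=> x f; rewrite !pow_coordE act_powE. Qed.

(** Homomorphisms into S separate the points of a quotient of a power of S:
    the intersection of the coordinate kernels is zero, so Y has a complement
    C; project onto C along Y and take a coordinate that does not vanish. *)
Lemma pow_mod_separate (J : finType) S (Y : {vspace pow_mod J S}) f :
  irreducible S -> submodule Y -> f \notin Y ->
  exists psi : 'Hom(pow_mod J S, S),
    [/\ mod_hom psi, forall y, y \in Y -> psi y = 0 & psi f != 0].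
Proof.
move=> irrS sY nYf.
pose maxl Q := exists2 j : J, Q = lker (pow_coord S j) & pow_coord S j <> 0.
have [|C [sC CY CYcap]] := @relative_complement (pow_mod J S) maxl Y _ sY.
  by move=> _ [j -> nz]; apply: lker_maximal => //; apply: pow_coord_hom.
have CY0 : (C :&: Y = 0)%VS.
  apply/eqP; rewrite -subv0; apply/subvP=> g CYg.
  rewrite memv0; apply/eqP/ffunP=> j; rewrite [RHS]ffunE -pow_coordE.
  have [->|nz] := pselect (pow_coord S j = 0); first by rewrite zero_lfunE.
  by apply/eqP; rewrite -memv_ker; apply: (subvP (CYcap _ _)) CYg; exists j.
pose pr := daddv_pi C Y.
have key g : pr g + daddv_pi Y C g = g by rewrite daddv_pi_add ?CY ?memvf.
have prC c : c \in C -> pr c = c by move=> /(daddv_pi_id CY0).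
have prY y : y \in Y -> pr y = 0.
  move=> Yy; apply: (addIr (daddv_pi Y C y)); rewrite key add0r.
  by rewrite daddv_pi_id // capvC.
have hpr : @mod_hom F X (pow_mod J S) (pow_mod J S) pr.
  move=> x g; rewrite -[in LHS](key g) !linearD /=.
  rewrite (prC (act _ x (pr g))) ?sC ?memv_pi //.
  by rewrite (prY (act _ x _)) ?addr0 ?sY ?memv_pi.
have : exists j, (pr f) j != 0.
  apply: contrapT => /forallNP nz; case/negP: nYf.
  rewrite -[f]key (_ : pr f = 0) ?add0r ?memv_pi //.
  by apply/ffunP=> j; rewrite [RHS]ffunE; apply: contrapT => nj;
    apply: (nz j); apply/eqP.
case=> j nz; exists (pow_coord S j \o pr)%VF; split.
- exact: (mod_hom_comp hpr (@pow_coord_hom _ _ j)).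
- by move=> y /prY; rewrite comp_lfunE => ->; rewrite linear0.
- by rewrite comp_lfunE pow_coordE.
Qed.

(** Compare dimensions along the images of the U i under g.  Such an image
    grows only if U i.+1 / U i is isomorphic to S, by [pow_mod_separate] and
    Schur's lemma, and then by at most dim S; in total it grows by
    #|J| * dim S. *)
Lemma leq_comp_mult_pow (J : finType) S M n (U : nat -> {vspace M})
    (g : 'Hom(M, pow_mod J S)) :
  irreducible S -> comp_series n U -> mod_hom g -> limg g = fullv ->
  (#|J| <= comp_mult n U S)%N.
Proof.
move=> irrS [U0 Un sU facU] hg img.
pose iso i := `[< mod_iso (factor (U i.+1) (U i)) S >].
have step i : (i < n)%N ->
    (\dim (g @: U i.+1) <= \dim (g @: U i) + iso i * dim S)%N.
  move=> lt_in; have [UW irrUW] := facU i lt_in.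
  have sUi := sU i (ltnW lt_in); have sUi1 := sU i.+1 lt_in.
  have [sub|/subvPn[_ /memv_imgP[w Ww ->] nw]] :=
    boolP (g @: U i.+1 <= g @: U i)%VS.
    by rewrite (leq_trans (dimvS sub)) ?leq_addr.
  have [psi [hpsi psi0 psin]] :=
    pow_mod_separate irrS (submodule_limg hg sUi) nw.
  have isoi : mod_iso (factor (U i.+1) (U i)) S.
    apply: (@factor_iso M S _ _ (psi \o g)%VF w) => //.
    - exact: mod_hom_comp.
    - by move=> u Uu; rewrite comp_lfunE psi0 ?memv_img.
    - by rewrite comp_lfunE.
  rewrite /iso asboolT // mul1n.
  have UWE : (U i + (U i.+1 :\: U i) = U i.+1)%VS.
    by rewrite addvC addv_diff; apply/addv_idPl.
  rewrite -[in X in (X <= _)%N]UWE limgD (leq_trans (dimv_add_leqif _ _)) //.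
  rewrite leq_add2l (@leq_trans (\dim (U i.+1 :\: U i))) //.
    by rewrite -(limg_ker_dim g (_ :\: _)) leq_addl.
  have := dimv_cap_compl (U i.+1) (U i); rewrite (capv_idPr UW) (dim_factor UW).
  by move/addnI ->; rewrite (mod_iso_dim isoi).
have sum i : (i <= n)%N ->
    (\dim (g @: U i) <= (\sum_(l < i) iso l) * dim S)%N.
  elim: i => [|i IH] lt_in; first by rewrite U0 limg0 dimv0.
  rewrite big_ord_recr /= mulnDl (leq_trans (step i lt_in)) // leq_add2r.
  exact/IH/ltnW.
have := sum n (leqnn n); rewrite Un img dimvf.
have dS : (0 < dim S)%N by case: irrS => + _; rewrite -dimvf lt0n dimv_eq0.
rewrite (_ : dim _ = #|J| * dim S)%N // leq_pmul2r //.
suff -> : comp_mult n U S = (\sum_(l < n) iso l)%N by [].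
rewrite /comp_mult -sum1_card big_mkcond /=; apply: eq_bigr => i _.
by rewrite inE /iso; case: asbool.
Qed.
End Submodules.

(** * The radical and projective covers *)
Section AlgebraModules.

Variables (F : fieldType) (A : falgType F).
Implicit Types M N P : opmod F A.

Definition regular_mod : opmod F A := @OpMod F A A (fun a => amull a).

Definition orbit_map M (v : M) : 'Hom(regular_mod, M) :=
  linfun (fun a : A => act M a v).

Lemma orbit_mapE M (v : M) a : algebra_module M -> orbit_map v a = act M a v.
Proof.
move=> [lin_act _ _]; rewrite linfunE // => c x y.
by rewrite lin_act add_lfunE scale_lfunE.
Qed.

Lemma act1 M (v : M) : algebra_module M -> act M 1 v = v.
Proof. by move=> [_ -> _]; rewrite id_lfunE. Qed.

Lemma actM M a b (v : M) :
  algebra_module M -> act M (a * b) v = act M a (act M b v).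
Proof. by move=> [_ _ ->]; rewrite comp_lfunE. Qed.

Lemma orbit_map_hom M (v : M) : algebra_module M -> mod_hom (orbit_map v).
Proof. by move=> mM x a; rewrite !orbit_mapE // lfunE /= actM. Qed.

Lemma left_idealP (I : {vspace A}) :
  left_ideal I <-> @submodule F A regular_mod I.
Proof.
split=> lI a x Ix; first by rewrite lfunE /=; apply: lI.
by have := lI a x Ix; rewrite lfunE.
Qed.

Lemma maximal_left_idealP (I : {vspace A}) :
  maximal_left_ideal I <-> @maximal_submodule F A regular_mod I.
Proof.
split=> -[lI nI mI]; split=> //; try exact/left_idealP.
  by move=> Z /left_idealP sZ IZ; apply: mI.
by move=> Z /left_idealP sZ IZ; apply: mI.
Qed.

(** The annihilator of a nonzero vector of an irreducible module is a maximal
    left ideal. *)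
Lemma jacobson_irreducible M a (v : M) :
  algebra_module M -> irreducible M -> a \in jacobson A -> act M a v = 0.
Proof.
move=> mM irrM /mem_jacobson Ja; rewrite -orbit_mapE //; apply/eqP.
have [->|nz] := pselect (orbit_map v = 0); first by rewrite zero_lfunE.
rewrite -memv_ker; apply/Ja/maximal_left_idealP/lker_maximal => //.
exact: orbit_map_hom.
Qed.

Lemma left_ideal_jacobson : left_ideal (jacobson A).
Proof.
move=> a x /mem_jacobson Jx; apply/mem_jacobson => I mI.
by case: (mI) => lI _ _; apply/lI/Jx.
Qed.

Lemma left_ideal_prod (I K : {vspace A}) :
  left_ideal I -> left_ideal (I * K)%VS.
Proof.
move=> lI a x IKx.
suff /subvP/(_ _ IKx) : (I * K <= amull a @^-1: (I * K))%VS.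
  by rewrite -memv_preim lfunE.
apply/prodvP=> u v Iu Kv; rewrite -memv_preim lfunE /= mulrA.
by rewrite memv_mul ?lI.
Qed.

Lemma ideal_mul_act (I : {vspace A}) M a (v : M) :
  algebra_module M -> a \in I -> act M a v \in ideal_mul I M.
Proof.
move=> mM Ia; have mv (b : A) (w : M) : b \in vbasis I ->
    w \in vbasis (fullv : {vspace M}) -> act M b w \in ideal_mul I M.
  by move=> Ib fw; apply/memv_span/allpairsP; exists (b, w).
rewrite (coord_vbasis (memvf v)) linear_sum /= memv_suml // => i _.
rewrite linearZ /= memvZ // -orbit_mapE // (coord_vbasis Ia) linear_sum /=.
rewrite memv_suml // => j _; rewrite linearZ memvZ //= orbit_mapE //.
by rewrite mv // mem_nth ?size_tuple.
Qed.

Lemma ideal_mul_sub (I : {vspace A}) M (W : {vspace M}) :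
  (forall a v, a \in I -> act M a v \in W) -> (ideal_mul I M <= W)%VS.
Proof.
move=> sub; apply/span_subvP=> _ /allpairsP[[a v] [/= Ia _ ->]].
exact/sub/(vbasis_mem Ia).
Qed.

Lemma submodule_ideal_mul (I : {vspace A}) M :
  algebra_module M -> left_ideal I -> submodule (ideal_mul I M).
Proof.
move=> mM lI x v Iv.
suff /subvP/(_ _ Iv) : (ideal_mul I M <= act M x @^-1: ideal_mul I M)%VS.
  by rewrite -memv_preim.
apply: ideal_mul_sub => a w Ia; rewrite -memv_preim -actM //.
exact/ideal_mul_act/lI.
Qed.

(** Choose v outside the kernel and let Q, a maximal left ideal, consist of
    the a with pi (a v) = 0.  Modulo the radical Q has a complement C.  As C v
    and the kernel add up to P, and the kernel is superfluous, C v = P; so a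
    vector of the kernel is c v with c in C :&: Q, which is inside the
    radical. *)
Lemma cover_kernel (T P : opmod F A) (pi : 'Hom(P, T)) :
  algebra_module T -> irreducible T -> projective_cover pi ->
  (lker pi <= ideal_mul (jacobson A) P)%VS.
Proof.
move=> mT irrT [[mP _] hpi impi small].
have /vspaceP fT0 : fullv <> 0%VS :> {vspace T} by case: irrT => /eqP.
have [t nt] : exists t : T, t <> 0.
  apply: contrapT => /forallNP t0; apply: fT0 => t.
  by rewrite memvf memv0; apply/esym/eqP; apply: contrapT => /t0.
have /memv_imgP[v _ Ev] : t \in limg pi by rewrite impi memvf.
have horb := orbit_map_hom v mP.
have hf : mod_hom (pi \o orbit_map v)%VF by apply: mod_hom_comp.
set f := (pi \o orbit_map v)%VF in hf.
have fE a : f a = pi (act P a v) by rewrite comp_lfunE orbit_mapE.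
have nf : f <> 0.
  by move/lfunP/(_ 1); rewrite zero_lfunE fE act1 // -Ev.
have [sQ nQ maxQ] := lker_maximal irrT hf nf.
have [C [sC CQ Ccap]] :=
  @relative_complement F A regular_mod _ _
    (fun Q => (maximal_left_idealP Q).1) sQ.
have imC : (orbit_map v @: C)%VS = fullv.
  apply: small; first exact: submodule_limg.
  apply/eqP; rewrite eqEsubv subvf /=; apply/subvP=> w _.
  have : pi w \in (f @: fullv)%VS.
    have [_ /(_ (limg f)) []//] := irrT.
    - by apply: submodule_limg => // x u _; apply: memvf.
    - move=> f0; case: nf; apply/lfunP=> x; apply/eqP.
      by rewrite zero_lfunE -memv0 -f0 memv_img ?memvf.
    - by move=> ->; rewrite memvf.
  rewrite -CQ limgD.
  have -> : (f @: lker f)%VS = 0%VS by apply/eqP; rewrite -lkerE.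
  rewrite addv0 => /memv_imgP[c Cc Ew].
  rewrite -[w](subrK (orbit_map v c)) addrC memv_add ?memv_img //.
  by rewrite memv_ker linearB /= Ew comp_lfunE subrr.
apply/subvP=> w; rewrite memv_ker => /eqP pw.
have : w \in (orbit_map v @: C)%VS by rewrite imC memvf.
case/memv_imgP=> c Cc Ew; rewrite Ew orbit_mapE // ideal_mul_act //.
apply/mem_jacobson=> I /Ccap /subvP; apply.
by rewrite memv_cap Cc memv_ker fE -orbit_mapE // -Ew pw /=.
Qed.

End AlgebraModules.

(** * Equivariant maps over the enveloping algebra *)
Section EnvelopingHom.

Variables (F : fieldType) (p : nat) (L : restrictedLieAlg F p).
Variables (A : falgType F) (iota : {linear L -> A}).
Hypothesis uLP : restricted_enveloping iota.

(** The uniqueness part of the universal property, applied to the two algebra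
    morphisms into End(V); this replaces the fact that the image of L generates
    the enveloping algebra. *)
Lemma env_act_unique (V : vectType F) (r1 r2 : A -> 'End(V)) :
  algebra_module (OpMod r1) -> algebra_module (OpMod r2) ->
  (forall x, r1 (iota x) = r2 (iota x)) -> forall a, r1 a = r2 a.
Proof.
move=> m1 m2 E12 a; have [dV0|dV] := posnP (dim V).
  apply/lfunP=> v; suff V0 (w : V) : w = 0 by rewrite [LHS]V0 [RHS]V0.
  have := memvf w; have /eqP : \dim {:V} = 0%N by rewrite dimvf.
  by rewrite dimv_eq0 => /eqP ->; rewrite memv0 => /eqP.
pose B := end_algType dV.
have lr (r : A -> 'End(V)) : algebra_module (OpMod r) ->
    exists g : {lrmorphism A -> B}, forall b, g b = r b :> 'End(V).
  move=> [lin one mul].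
  pose ml := GRing.isLinear.Build F A B *:%R (r : A -> B) lin.
  pose mm := GRing.isMonoidMorphism.Build A B (r : A -> B) (conj one mul).
  by pose g : {lrmorphism A -> B} := HB.pack (r : A -> B) ml mm; exists g.
have [g1 g1E] := lr _ m1; have [g2 g2E] := lr _ m2.
pose f : {linear L -> B} := g1 \o iota.
have hf : restricted_hom f.
  have [[ibr ip] _] := uLP; split=> [x y|x] /=.
    by rewrite ibr rmorphB !rmorphM.
  by rewrite ip rmorphXn.
have [_ uniq] := uLP.2 B f hf.
by rewrite -g1E -g2E (uniq g1 g2) // => x /=; rewrite [LHS]g1E [RHS]g2E E12.
Qed.

(** Conjugate the action on the product M x N by (m, n) |-> (m, n + f m).  The
    original and the conjugated action agree on L if f is L-equivariant, hence
    everywhere, and their agreement at (v, 0) is equivariance of f at v. *)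
Lemma env_hom (M N : opmod F A) (f : 'Hom(M, N)) :
  algebra_module M -> algebra_module N ->
  (forall x v, f (act M (iota x) v) = act N (iota x) (f v)) -> mod_hom f.
Proof.
move=> mM mN hf.
pose V : vectType F := (M * N)%type.
(* r1 is the direct sum, r2 its conjugate by (m, n) |-> (m, n + f m). *)
pose r1 a : 'End(V) := linfun (fun u : V => (act M a u.1, act N a u.2)).
pose r2 a : 'End(V) := linfun (fun u : V =>
  (act M a u.1, act N a (u.2 - f u.1) + f (act M a u.1))).
have r1E a u : r1 a u = (act M a u.1, act N a u.2).
  by rewrite linfunE // => c [m n] [m' n']; rewrite /= !linearP.
have r2E a u : r2 a u = (act M a u.1, act N a (u.2 - f u.1) + f (act M a u.1)).
  rewrite linfunE // => c [m n] [m' n'] /=; congr pair; rewrite !linearP //=.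
  by rewrite addrACA -scalerDr linearP [in RHS]scalerDr addrACA.
have [linM oneM mulM] := mM; have [linN oneN mulN] := mN.
have m1 : algebra_module (OpMod r1).
  split=> [c a b||a b]; apply/lfunP=> -[m n].
  - rewrite add_lfunE scale_lfunE !r1E /= linM linN.
    by rewrite !add_lfunE !scale_lfunE.
  - by rewrite id_lfunE r1E /= !act1.
  - by rewrite comp_lfunE !r1E /= !actM.
have m2 : algebra_module (OpMod r2).
  split=> [c a b||a b]; apply/lfunP=> -[m n].
  - rewrite add_lfunE scale_lfunE !r2E /= linM linN.
    rewrite !add_lfunE !scale_lfunE linearP; congr pair.
    by rewrite /= scalerDr addrACA.
  - by rewrite id_lfunE r2E /= !act1 // subrK.
  - by rewrite comp_lfunE !r2E /= !actM // addrK.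
have E12 x : r1 (iota x) = r2 (iota x).
  by apply/lfunP=> u; rewrite r1E r2E hf -linearD subrK.
move=> a v; have /lfunP/(_ (v, 0)) := env_act_unique m1 m2 E12 a.
rewrite r1E r2E /= linear0 sub0r linearN => -[/eqP].
by rewrite eq_sym addrC subr_eq0 => /eqP.
Qed.

End EnvelopingHom.

(** * Extensions of the trivial module by derivations *)
Section LieModules.

Variables (F : fieldType) (p : nat).

(** In End(M) the bracket with X = act M x is the difference of left and right
    multiplication by X; these commute, so in characteristic p the p-th power
    of the difference is the difference of the p-th powers. *)
Lemma act_ad_pchar (L : lieAlg F) (M : opmod F L) x y v :
  p \in [pchar F] -> lie_module M ->
  act M (iter p (br x) y) v =
    iter p (act M x) (act M y v) - act M y (iter p (act M x) v).
Proof.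
move=> charF [linM brM]; have [dM0|dM] := posnP (dim M).
  suff M0 (w : M) : w = 0 by rewrite [LHS]M0 [RHS]M0.
  have := memvf w; have /eqP : \dim {:M} = 0%N by rewrite dimvf.
  by rewrite dimv_eq0 => /eqP ->; rewrite memv0 => /eqP.
have dE : (0 < dim 'End(M))%N by rewrite muln_gt0 dM.
pose B := end_algType dE.
pose l : B := linfun (fun g : 'End(M) => (act M x \o g)%VF).
pose r : B := linfun (fun g : 'End(M) => (g \o act M x)%VF).
have lE (g : 'End(M)) : (l : 'End('End(M))) g = (act M x \o g)%VF.
  by rewrite linfunE // => c g1 g2; rewrite comp_lfunDr comp_lfunZr.
have rE (g : 'End(M)) : (r : 'End('End(M))) g = (g \o act M x)%VF.
  by rewrite linfunE // => c g1 g2; rewrite comp_lfunDl comp_lfunZl.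
have mulE (a b : B) (g : 'End(M)) :
  (a * b : 'End('End(M))) g = (a : 'End('End(M))) ((b : 'End('End(M))) g).
  exact: comp_lfunE.
have subE (a b : B) (g : 'End(M)) : (a - b : 'End('End(M))) g =
    (a : 'End('End(M))) g - (b : 'End('End(M))) g.
  by rewrite add_lfunE opp_lfunE.
have powl n (g : 'End(M)) w :
    ((l ^+ n : B) : 'End('End(M))) g w = iter n (act M x) (g w).
  elim: n => [|n IH]; first by rewrite expr0 id_lfunE.
  by rewrite exprS mulE lE comp_lfunE IH.
have powr n (g : 'End(M)) w :
    ((r ^+ n : B) : 'End('End(M))) g w = g (iter n (act M x) w).
  elim: n w => [|n IH] w; first by rewrite expr0 id_lfunE.
  by rewrite exprS mulE rE comp_lfunE IH -iterSr.
have powd n : act M (iter n (br x) y) =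
    (((l - r) ^+ n : B) : 'End('End(M))) (act M y).
  elim: n => [|n IH]; first by rewrite expr0 id_lfunE.
  rewrite exprS mulE -IH subE lE rE.
  by apply/lfunP=> w; rewrite /= brM add_lfunE opp_lfunE !comp_lfunE.
have charB : p \in [pchar B] by rewrite pchar_lalg.
have clr : GRing.comm l r.
  have mlr g : (l * r : 'End('End(M))) g = (act M x \o (g \o act M x))%VF.
    by rewrite mulE lE rE.
  have mrl g : (r * l : 'End('End(M))) g = (act M x \o (g \o act M x))%VF.
    by rewrite mulE lE rE comp_lfunA.
  by apply/lfunP=> g; apply: etrans (mlr g) (esym (mrl g)).
have := pFrobenius_autB_comm charB clr; rewrite !pFrobenius_autE => fro.
rewrite powd fro subE [LHS]add_lfunE opp_lfunE.
by congr (_ - _); [apply: powl | apply: powr].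
Qed.

Definition derivation (L : lieAlg F) (M : opmod F L) (d : 'Hom(L, M)) : Prop :=
  forall x y, d (br x y) = act M x (d y) - act M y (d x).

Definition ext_mod (L : lieAlg F) (M : opmod F L) (d : 'Hom(L, M)) :
    opmod F L :=
  @OpMod F L (M * F^o)%type (fun x =>
    linfun (fun u : M * F^o => (act M x u.1 + u.2 *: d x, 0) : M * F^o)).

Lemma ext_actE (L : lieAlg F) (M : opmod F L) (d : 'Hom(L, M)) x u :
  act (ext_mod d) x u = (act M x u.1 + u.2 *: d x, 0).
Proof.
rewrite linfunE // => c [m t] [m' t'] /=; congr pair; last first.
  by rewrite [RHS]addr0 [RHS]mulr0.
by rewrite linearP /= scalerDl scalerDr scalerA addrACA.
Qed.

Lemma ext_lie_module (L : lieAlg F) (M : opmod F L) (d : 'Hom(L, M)) :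
  lie_module M -> derivation d -> lie_module (ext_mod d).
Proof.
move=> [linM brM] der; split=> [c x y|x y u].
  apply/lfunP=> u; rewrite add_lfunE scale_lfunE !ext_actE linM.
  congr pair; last by rewrite /= scaler0 addr0.
  rewrite /= add_lfunE scale_lfunE linearP !scalerDr addrACA.
  congr (_ + (_ + _)).
  by rewrite !scalerA mulrC.
rewrite !ext_actE /= !scale0r !addr0; congr pair; last by rewrite /= subr0.
rewrite brM der scalerBr /= [act M x (_ + _)]linearD [act M y (_ + _)]linearD.
rewrite /= [act M x (_ *: _)]linearZ [act M y (_ *: _)]linearZ /=.
by rewrite opprD addrACA.
Qed.

(** By induction x^p acts on (m, t) as (x^p m + t x^(p-1) d x, 0), so the claim
    is d (x^[p]) = x^(p-1) d x.  For any y, the derivation rule for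
    [y, x^[p]] = - (ad x)^p y and [act_ad_pchar] at (0, 1) show that y kills the
    difference of the two sides. *)
Lemma ext_restricted (L : restrictedLieAlg F p) (M : opmod F L)
    (d : 'Hom(L, M)) :
  p \in [pchar F] -> restricted_module M ->
  (forall m, (forall x, act M x m = 0) -> m = 0) ->
  derivation d -> restricted_module (ext_mod d).
Proof.
move=> charF [lieM pM] inv der.
have lieE := ext_lie_module lieM der; split=> // x u.
have p_gt0 : (0 < p)%N by rewrite prime_gt0 ?(pcharf_prime charF).
have itE n m t : iter n.+1 (act (ext_mod d) x) (m, t) =
    (iter n.+1 (act M x) m + t *: iter n (act M x) (d x), 0).
  elim: n => [|n IH]; first by rewrite /= ext_actE.
  by rewrite iterS IH ext_actE /= scale0r addr0 linearD linearZ.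
pose q := p.-1.
have iterp (T : Type) (f : T -> T) t : iter p f t = f (iter q f t).
  by rewrite -[in LHS](prednK p_gt0).
have itpE m t : iter p (act (ext_mod d) x) (m, t) =
    (iter p (act M x) m + t *: iter q (act M x) (d x), 0).
  by rewrite !iterp; apply: itE.
suff dp : d (Defs.pmap x) = iter q (act M x) (d x).
  by case: u => m t; rewrite itpE ext_actE /= dp pM.
apply/eqP; rewrite -subr_eq0; apply/eqP/inv=> y; rewrite linearB /=.
have it0 n : iter n (act M x) 0 = 0 by elim: n => //= n ->; rewrite linear0.
pose e : ext_mod d := (0, 1).
have act0 z : act M z 0 = 0 by rewrite linear0.
have := act_ad_pchar x y e charF lieE.
rewrite [act _ y e]ext_actE !itpE !ext_actE /=.
rewrite !(scale1r, scale0r, it0, act0, add0r, addr0).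
case=> Ead _.
move: (der y (Defs.pmap x)); rewrite brC linearN br_pmap /= Ead pM.
by rewrite opprB => /addIr <-; rewrite subrr.
Qed.

End LieModules.

(** * Derivations from split chief factors *)
Section ChiefFactors.

Variable F : fieldType.
Implicit Type L : lieAlg F.

(** With q and q' the projections to L / I and L / J, the element
    q x - s (q' x) lies in J / I; its image in S is d x.  The derivation rule
    follows from expanding brackets, because J / I is abelian; for the same
    reason J acts trivially on J / I, that is, on S. *)
Lemma split_derivation L (I J : lideal L) (S : opmod F L) :
  (I <= J)%VS -> abelian_factor J I ->
  mod_iso (@factor F L (adjoint L) J I) S -> split_factor J I ->
  exists d : 'Hom(L, S), [/\ derivation d, forall x, x \in I -> d x = 0,
    forall m, exists2 x, x \in J & d x = m &
    forall x m, x \in J -> act S x m = 0].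
Proof.
move=> /subvP IJ abel [phi [hphi kphi imphi]] [s hs sK].
pose q := quot_proj I; pose q' := quot_proj J.
have sI : @submodule F L (adjoint L) I.
  move=> x y Iy; rewrite linfunE; first exact: lidealP.
  exact: br_linr.
have adE x y : act (adjoint L) x y = br x y.
  by rewrite linfunE //; apply: br_linr.
have q_br x y : q (br x y) = @br F (quot_lie I) (q x) (q y).
  exact: quot_proj_br.
have q'_br x y : q' (br x y) = @br F (quot_lie J) (q' x) (q' y).
  exact: quot_proj_br.
(* c x represents q x - s (q' x) in L. *)
pose c : 'Hom(L, L) := (quot_repr I \o (q - (s \o q')%VF)%R)%VF.
have qc x : q (c x) = q x - s (q' x).
  rewrite [c x]comp_lfunE [LHS]quot_reprK [LHS]add_lfunE [X in _ + X]opp_lfunE.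
  by rewrite [X in _ - X]comp_lfunE.
have qqE x : quot_quot J I (q x) = q' x.
  rewrite [LHS]comp_lfunE; apply/esym/eq_quot_proj/IJ/quot_repr_sub.
have cJ x : c x \in J.
  rewrite -quot_proj_eq0 -/q' -qqE qc linearB /= sK qqE.
  by rewrite subrr.
pose fp : 'Hom(L, _) := @factor_proj F L (adjoint L) J I.
have fpE x y : q x = q y -> fp x = fp y.
  move=> E; apply: etrans (@factor_projE F L (adjoint L) J I x) _.
  by apply/esym/(etrans (@factor_projE F L (adjoint L) J I y)); congr vsproj.
have fp_act x w : w \in J -> act S x (phi (fp w)) = phi (fp (br x w)).
  move=> Jw; rewrite -hphi; congr (phi _).
  by rewrite -(@factor_proj_act _ _ (adjoint L) J I x w sI Jw) adE.
pose d : 'Hom(L, S) := (phi \o fp \o c)%VF.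
have dE x : d x = phi (fp (c x)) by rewrite !comp_lfunE.
have surj m : exists2 x, x \in J & phi (fp x) = m.
  have : m \in limg phi by rewrite imphi memvf.
  by case/memv_imgP=> t _ ->; have [w Jw ->] := factor_projP t; exists w.
have key (X Y A B : quot_lie I) : br (X - A) (Y - B) = 0 ->
    br X Y - br A B = br X (Y - B) - br Y (X - A).
  rewrite !brBl !brBr (brC Y X) (brC Y A) => /eqP; rewrite subr_eq0 => /eqP ->.
  by rewrite opprD !opprK [RHS]addrC addrA subrK.
exists d; split.
- move=> x y; rewrite !dE !fp_act // -!linearB; congr (phi _).
  apply: fpE; rewrite linearB /= !q_br qc q_br q'_br hs !qc.
  by apply: key; rewrite -!qc; apply: abel; apply: memv_img.
- move=> x Ix; rewrite dE (fpE _ 0) ?linear0 // qc.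
  have /eqP -> : q x == 0 by rewrite quot_proj_eq0.
  have /eqP -> : q' x == 0 by rewrite quot_proj_eq0 IJ.
  by rewrite linear0 subrr.
- move=> m; have [x Jx <-] := surj m; exists x => //.
  rewrite dE; congr (phi _); apply: fpE; rewrite qc.
  have /eqP -> : q' x == 0 by rewrite quot_proj_eq0.
  by rewrite linear0 subr0.
- move=> x m Jx; have [w Jw <-] := surj m.
  rewrite fp_act // (fpE _ 0) ?linear0 //.
  by rewrite q_br abel ?memv_img // linear0.
Qed.

Lemma chief_series_le L n (I : nat -> lideal L) i j :
  chief_series n I -> (i <= j <= n)%N -> (I i <= I j)%VS.
Proof.
move=> [_ _ chI] /andP[/subnK <-]; elim: (j - i)%N => [|l IH] ln.
  exact: subvv.
exact: subv_trans (IH (ltnW ln)) (chI _ ln).1.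
Qed.

Lemma dim1_irreducible (X : Type) (M : opmod F X) :
  dim M = 1%N -> irreducible M.
Proof.
move=> dM; split; first by rewrite -dimv_eq0 dimvf dM.
move=> U _; have := dimvS (subvf U); rewrite dimvf dM.
case E: (\dim U) => [|[|//]] _.
  by left; apply/eqP; rewrite -dimv_eq0 E.
by right; apply/eqP; rewrite eqEdim subvf dimvf dM E.
Qed.

Lemma trivial_irreducible L : irreducible (trivial_module L).
Proof. exact: dim1_irreducible. Qed.

(** The line through a nonzero invariant vector would be a submodule. *)
Lemma no_invariants L (S : opmod F L) :
  irreducible S -> ~ mod_iso S (trivial_module L) ->
  forall m, (forall x, act S x m = 0) -> m = 0.
Proof.
move=> irrS ntS m m0; apply: contrapT => /eqP nm; case: ntS.
have line v : exists a, v = a *: m.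
  have [|m_0|m_full] := irrS.2 <[m]>%VS.
  - by move=> x _ /vlineP[a ->]; rewrite linearZ /= m0 scaler0 mem0v.
  - by case/negP: nm; rewrite -memv0 -m_0 memv_line.
  - by apply/vlineP; rewrite m_full memvf.
pose f : 'Hom(S, trivial_module L) := linfun (coord [tuple m] ord0 : S -> F^o).
have fE a : f (a *: m) = a.
  have frm : free [tuple m] by rewrite seq1_free.
  have fm : f m = 1.
    by rewrite lfunE /= -[m]/([tuple m]`_0) (coord_free 0 0 frm).
  by rewrite linearZ /= fm [LHS]mulr1.
apply: (schur (f := f)) => //; first exact: trivial_irreducible.
  move=> x v; have [a ->] := line v.
  by rewrite linearZ /= m0 scaler0 linear0 zero_lfunE.
move=> /lfunP/(_ m); rewrite -[m]scale1r fE zero_lfunE => /eqP.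
by rewrite oner_eq0.
Qed.

End ChiefFactors.

Lemma trivial_restricted (F : fieldType) p (L : restrictedLieAlg F p) :
  p \in [pchar F] -> restricted_module (trivial_module L).
Proof.
move=> charF; have p_gt0 : (0 < p)%N by rewrite prime_gt0 ?(pcharf_prime charF).
split; [split=> [a x y|x y v]|move=> x v].
- by rewrite scaler0 addr0.
- by rewrite !zero_lfunE subrr.
- have it0 n : (0 < n)%N -> iter n (act (trivial_module L) x) v = 0.
    by case: n => // n _; rewrite iterS zero_lfunE.
  by rewrite it0 // zero_lfunE.
Qed.

Lemma pow_restricted (F : fieldType) p (L : restrictedLieAlg F p) (J : finType)
    (S : opmod F L) : restricted_module S -> restricted_module (pow_mod J S).
Proof.
move=> [[linS brS] pS]; split; [split=> [a x y|x y v]|move=> x v].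
- apply/lfunP=> f; apply/ffunP=> j; rewrite add_lfunE scale_lfunE.
  by rewrite !ffunE !act_powE linS add_lfunE scale_lfunE.
- by apply/ffunP=> j; rewrite !ffunE !act_powE brS.
- apply/ffunP=> j; rewrite act_powE pS.
  have it n : iter n (act (pow_mod J S) x) v j = iter n (act S x) (v j).
    by elim: n => //= n <-; rewrite act_powE.
  by rewrite it.
Qed.

(** * The extension by a power and the first radical layer *)
Definition pow_der (F : fieldType) (L : lieAlg F) (J : finType) (S : opmod F L)
    (d : J -> 'Hom(L, S)) : 'Hom(L, pow_mod J S) :=
  linfun (fun x => [ffun j => d j x] : pow_mod J S).

Lemma pow_derE (F : fieldType) (L : lieAlg F) (J : finType) (S : opmod F L)
    (d : J -> 'Hom(L, S)) x j : pow_der d x j = d j x.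
Proof.
by rewrite linfunE ?ffunE // => a y z; apply/ffunP=> i; rewrite !ffunE linearP.
Qed.

Lemma pow_der_derivation (F : fieldType) (L : lieAlg F) (J : finType)
    (S : opmod F L) (d : J -> 'Hom(L, S)) :
  (forall j, derivation (d j)) -> derivation (pow_der d).
Proof.
move=> der x y; apply/ffunP=> j; rewrite pow_derE der.
by rewrite !ffunE !act_powE !pow_derE.
Qed.

(** This says that an L-submodule of the extension of F by d containing a
    vector (n0, 1) contains all of N. *)
Definition cocycle_spans (F : fieldType) (L : lieAlg F) (N : opmod F L)
    (d : 'Hom(L, N)) : Prop :=
  forall (V : {vspace N}) n0, (forall x, act N x n0 + d x \in V) -> V = fullv.

(** The index j has rank rk j in the chief series.  For x in I (rk j).+1, x
    kills n0, and d i x = 0 for all i of larger rank; so if V contains the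
    copies of S of smaller rank, then it contains d j x in the copy with
    index j, and d j x is arbitrary. *)
Lemma pow_der_spans (F : fieldType) (L : lieAlg F) (J : finType)
    (S : opmod F L) (d : J -> 'Hom(L, S)) (I : nat -> lideal L)
    (rk : J -> nat) :
  (forall i j, i != j -> (rk i < rk j)%N || (rk j < rk i)%N) ->
  (forall i j, (rk i < rk j)%N -> (I (rk i).+1 <= I (rk j))%VS) ->
  (forall j x, x \in I (rk j) -> d j x = 0) ->
  (forall j m, exists2 x, x \in I (rk j).+1 & d j x = m) ->
  (forall j x m, x \in I (rk j).+1 -> act S x m = 0) ->
  cocycle_spans (pow_der d).
Proof.
move=> rk_inj mono d0 surj triv V n0 inV.
pose inc j m : pow_mod J S := [ffun i => if i == j then m else 0].
have decomp (n : pow_mod J S) : n = \sum_j inc j (n j).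
  apply/ffunP=> i; rewrite sum_ffunE (bigD1 i) //= ffunE eqxx.
  by rewrite big1 ?addr0 // => j ji; rewrite ffunE eq_sym (negPf ji).
suff incV l j m : (rk j < l)%N -> inc j m \in V.
  apply/eqP; rewrite eqEsubv subvf /=; apply/subvP=> n _.
  by rewrite (decomp n) memv_suml // => j _; apply: incV (ltnSn _).
elim: l j m => [//|l IH] j m; rewrite ltnS => rkj.
have [x Ix dx] := surj j m.
have xn0 : act (pow_mod J S) x n0 = 0.
  by apply/ffunP=> i; rewrite act_powE (triv j) // ffunE.
have := inV x; rewrite xn0 add0r (decomp (pow_der d x)) (bigD1 j) //=.
rewrite pow_derE dx rpredDr // memv_suml // => i ij; rewrite pow_derE.
case/orP: (rk_inj _ _ ij) => [lt_ij|lt_ji].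
  by apply: IH; apply: leq_trans rkj.
rewrite d0; last exact: (subvP (mono _ _ lt_ji)).
suff -> : inc i 0 = 0 by rewrite mem0v.
by apply/ffunP=> e; rewrite !ffunE if_same.
Qed.

Section ProjectiveCover.

Variables (F : fieldType) (p : nat) (L : restrictedLieAlg F p).
Variables (A : falgType F) (iota : {linear L -> A}).
Hypothesis charF : p \in [pchar F].
Hypothesis uLP : restricted_enveloping iota.

Lemma env_irreducible (S : opmod F L) :
  restricted_module S -> irreducible S -> irreducible (env_module iota S).
Proof.
move=> rS [nS irrS]; split=> // U sU; apply: irrS => x v Uv.
by have [_ <-] := env_moduleP uLP rS; apply: sU.
Qed.

Lemma env_lie_hom (M N : opmod F L) (f : 'Hom(M, N)) :
  restricted_module M -> restricted_module N -> mod_hom f ->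
  @mod_hom F A (env_module iota M) (env_module iota N) f.
Proof.
move=> rM rN hf; have [mM ME] := env_moduleP uLP rM.
have [mN NE] := env_moduleP uLP rN.
by apply: (env_hom uLP mM mN) => x v; rewrite ME NE hf.
Qed.

(** The lift h of pi to the extension E of F by d maps the kernel of pi onto N,
    by [cocycle_spans]; this kernel is J P, and h (J^2 P) is inside J N = 0. *)
Lemma radical_layer_onto (P : opmod F A)
    (pi : 'Hom(P, env_module iota (trivial_module L)))
    (N : opmod F L) (d : 'Hom(L, N)) :
  projective_cover pi -> restricted_module N ->
  (forall m, (forall x, act N x m = 0) -> m = 0) ->
  (forall a m, a \in jacobson A -> act (env_module iota N) a m = 0) ->
  derivation d -> cocycle_spans d ->
  exists2 g : 'Hom(factor (ideal_mul (jacobson A) P)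
      (ideal_mul (jacobson A ^+ 2)%VS P), env_module iota N),
    mod_hom g & limg g = fullv.
Proof.
move=> cov rN inv JN der spans.
have rE := ext_restricted charF rN inv der.
have rT := trivial_restricted L charF.
set TA := env_module iota (trivial_module L) in pi cov *.
set NA := env_module iota N.
pose EA := env_module iota (ext_mod d).
have [mT _] := env_moduleP uLP rT.
have [mN _] := env_moduleP uLP rN.
have [mE EE] : algebra_module EA /\ _ := env_moduleP uLP rE.
have irrT : irreducible TA.
  exact/(env_irreducible rT)/trivial_irreducible.
have kerP := cover_kernel mT irrT cov.
have [[mP projP] hpi impi _] := cov.
pose inl : 'Hom(NA, EA) := linfun (fun n : N => (n, 0) : ext_mod d).
pose snd : 'Hom(EA, TA) := linfun (fun u : ext_mod d => u.2).
pose fst : 'Hom(EA, NA) := linfun (fun u : ext_mod d => u.1).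
have inlE n : inl n = (n, 0).
  rewrite linfunE // => a u v; congr pair.
  by rewrite [RHS]addr0 [RHS]mulr0.
have sndE u : snd u = u.2 by rewrite linfunE.
have fstE u : fst u = u.1 by rewrite linfunE.
have hinl : mod_hom inl.
  apply: env_lie_hom => // x n; rewrite [LHS]inlE [X in _ = act _ _ X]inlE.
  by rewrite ext_actE /= scale0r addr0.
have hsnd : mod_hom snd.
  apply: env_lie_hom => // x u.
  by rewrite [LHS]sndE ext_actE /= [RHS]zero_lfunE.
have imsnd : limg snd = fullv.
  apply/eqP; rewrite eqEsubv subvf /=; apply/subvP=> t _.
  have -> : t = snd ((0, t) : ext_mod d) by rewrite sndE.
  by rewrite memv_img ?memvf.
have [h hh sndh] := projP _ _ snd pi mE mT hsnd imsnd hpi.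
have sndhE w : (h w).2 = pi w by rewrite -sndh comp_lfunE sndE.
have inl_fst w : pi w = 0 -> h w = inl (h w).1.
  by move=> pw; rewrite inlE -pw -sndhE; case: (h w).
have onto n : exists2 w, pi w = 0 & h w = inl n.
  have /memv_imgP[v _ pv] : (1 : F^o) \in limg pi by rewrite impi memvf.
  have full : (inl @^-1: limg h)%VS = fullv.
    apply: (spans _ (h v).1) => x; rewrite -memv_preim.
    suff -> : inl (act N x (h v).1 + d x) = h (act P (iota x) v).
      by rewrite memv_img ?memvf.
    rewrite hh EE [RHS]ext_actE inlE; congr pair; congr (_ + _).
    by rewrite sndhE -pv scale1r.
  have : n \in (inl @^-1: limg h)%VS by rewrite full memvf.
  rewrite -memv_preim => /memv_imgP[w _ Ew]; exists w => //.
  by rewrite -sndhE -Ew inlE.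
set J := jacobson A; set JP := ideal_mul J P.
set J2P := ideal_mul (J ^+ 2)%VS P.
have lJ : left_ideal J := @left_ideal_jacobson F A.
have sJP : submodule JP by apply: submodule_ideal_mul.
have sJ2P : submodule J2P by exact/submodule_ideal_mul/left_ideal_prod.
have JPker w : w \in JP -> pi w = 0.
  suff /subvP sub : (JP <= lker pi)%VS by move/sub; rewrite memv_ker => /eqP.
  apply: ideal_mul_sub => a v Ja; rewrite memv_ker hpi.
  by rewrite (jacobson_irreducible _ mT irrT Ja).
pose g : 'Hom(P, NA) := (fst \o h)%VF.
have gE w : g w = (h w).1 by rewrite comp_lfunE fstE.
have ghom x w : w \in JP -> g (act P x w) = act NA x (g w).
  by move=> /JPker/inl_fst Ew; rewrite !gE hh {1}Ew -hinl inlE.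
have gJ2P w : w \in J2P -> g w = 0.
  suff /subvP sub : (J2P <= lker g)%VS by move/sub; rewrite memv_ker => /eqP.
  apply: ideal_mul_sub => a v JJa.
  suff /subvP/(_ _ JJa) : (J ^+ 2 <= (g \o orbit_map v) @^-1: 0)%VS.
    by rewrite -memv_preim memv0 comp_lfunE orbit_mapE // memv_ker.
  apply/prodvP=> b c Jb Jc; rewrite -memv_preim comp_lfunE orbit_mapE //.
  by rewrite actM // ghom ?ideal_mul_act // JN ?mem0v.
exists (factor_map JP J2P g); first exact: factor_map_hom.
apply/eqP; rewrite eqEsubv subvf /=; apply/subvP=> n _.
have [w pw hw] := onto n.
have JPw : w \in JP by apply: (subvP kerP); rewrite memv_ker pw.
have -> : n = factor_map JP J2P g (factor_proj JP J2P w).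
  by rewrite factor_mapE // gE hw inlE.
by rewrite memv_img ?memvf.
Qed.

End ProjectiveCover.

Theorem theorem5p1 (F : fieldType) (p : nat) (char_F : p \in [pchar F])
    (L : restrictedLieAlg F p)
    (uL : falgType F) (iota : {linear L -> uL})
    (uLP : restricted_enveloping iota)
    (P : opmod F uL) (pi : 'Hom(P, env_module iota (trivial_module L)))
    (P_cover : projective_cover pi)
    (S : opmod F L) (S_restr : restricted_module S) (S_irr : irreducible S)
    (S_nontriv : ~ mod_iso S (trivial_module L))
    (k : nat) (I : nat -> lideal L) (I_chief : chief_series k I)
    (n : nat)
    (U : nat -> {vspace (factor (ideal_mul (jacobson uL) P)
                                (ideal_mul (jacobson uL ^+ 2)%VS P))})
    (U_series : comp_series n U) :
  (split_mult k I S <= comp_mult n U (env_module iota S))%N.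
Proof.
rewrite /split_mult; set X := [set j | _].
pose J : finType := {j : 'I_k | j \in X}.
have -> : #|X| = #|J| by rewrite card_sig.
have I_le i j : (i <= j <= k)%N -> (I i <= I j)%VS by apply: chief_series_le.
have /choice [d dP] (j : J) : exists d : 'Hom(L, S), [/\ derivation d,
    forall x, x \in I (val j) -> d x = 0,
    forall m, exists2 x, x \in I (val j).+1 & d x = m &
    forall x m, x \in I (val j).+1 -> act S x m = 0].
  case: j => j /=; rewrite inE => /asboolP[abel iso split].
  by apply: split_derivation iso split => //; apply: I_le;
    rewrite leqnSn ltn_ord.
have spans : cocycle_spans (pow_der d).
  apply: (@pow_der_spans F L J S d I (fun j => val j)) => [i j|i j lt_ij|j|j|j].
  - by rewrite -neq_ltn.
  - by apply: I_le; rewrite lt_ij ltnW.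
  - by case: (dP j).
  - by case: (dP j).
  - by case: (dP j).
have der : derivation (pow_der d).
  by apply: pow_der_derivation => j; case: (dP j).
have invS := no_invariants S_irr S_nontriv.
have rN := pow_restricted J S_restr.
have irrSA := env_irreducible uLP S_restr S_irr.
have [mS _] := env_moduleP uLP S_restr.
have coordA a (f : pow_mod J S) j :
    act (env_module iota (pow_mod J S)) a f j = act (env_module iota S) a (f j).
  have := env_lie_hom uLP rN S_restr (@pow_coord_hom _ _ J S j) a f.
  by rewrite !pow_coordE.
have [|a m Ja|g hg img] :=
  radical_layer_onto char_F uLP P_cover rN _ _ der spans.
- move=> m m0; apply/ffunP=> j; rewrite ffunE; apply: invS => x.
  by rewrite -act_powE m0 ffunE.
- apply/ffunP=> j; rewrite coordA ffunE.
  exact: jacobson_irreducible mS irrSA Ja.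
apply: (@leq_comp_mult_pow F uL J (env_module iota S) _ n U g irrSA U_series _ img).
move=> a t; apply/ffunP=> j; rewrite hg [LHS]coordA.
by rewrite [RHS]act_powE.
Qed.
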